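(* Let $(X,\tau)$ be a metrizable space and $a\in X$. For $s,t\in\mathcal G_a(\tau)$, $$\tau_s\subseteq\tau_t\quad\Longleftrightarrow\quad s\preceq t.$$ Consequently, $\tau_s=\tau_t$ if and only if $s\asymp t$, and the map $$\mathcal G_a(\tau)/{\asymp}\longrightarrow\mathcal L^m_a(\tau),\qquad[s]\longmapsto\tau_s,$$ is an order isomorphism, where $\mathcal G_a(\tau)/{\asymp}$ carries the quotient order induced by $\preceq$ and $\mathcal L^m_a(\tau)$ is ordered by inclusion.
   Context: $X$ is a nonempty set. $\mathcal G_a(\tau)$ denotes the set of $\tau$-continuous functions $s:X\to[0,\infty)$ with $s^{-1}(0)=\{a\}$. Fix a metric $d\le1$ compatible with $\tau$ (inducing $\tau$). For $s\in\mathcal G_a(\tau)$, $\tau_s$ denotes the topology induced by the metric $\rho_s(x,y)=|s(x)-s(y)|+\min\{s(x),s(y)\}d(x,y)$; it does not depend on the choice of compatible $d\le1$. $\mathcal L^m_a(\tau)$ denotes the set of all metrizable topologies $\sigma$ on $X$ with $\sigma\subseteq\tau$ and $\sigma|_{X\setminus\{a\}}=\tau|_{X\setminus\{a\}}$ (equality of subspace topologies). For $s,t\in\mathcal G_a(\tau)$, $s\preceq t$ means: for every $\varepsilon>0$ there is $\delta>0$ with $\{x:t(x)<\delta\}\subseteq\{x:s(x)<\varepsilon\}$. Write $s\asymp t$ if $s\preceq t$ and $t\preceq s$. *)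

(* Defs.v *)
From HB Require Import structures.
From mathcomp Require Import all_boot all_order all_algebra generic_quotient.
From mathcomp Require Import all_classical all_reals all_analysis.
Set Implicit Arguments.
Unset Strict Implicit.
Unset Printing Implicit Defensive.
Import Order.TTheory GRing.Theory Num.Theory.
Import numFieldNormedType.Exports.
Local Open Scope classical_set_scope.
Local Open Scope ring_scope.

(* Several topologies on the same carrier are compared, so apart from the
   ambient one, which is the [open] of a [topologicalType], a topology is
   represented by its set of open sets, of type [set (set X)]. Likewise a
   metric is a bare function; on a [metricType] both notions agree with the
   canonical ones (see [metric_topology_mdist]). *)

Section metric_topologies.
Variables (R : realType) (X : Type).

Record is_metric (d : X -> X -> R) : Prop := IsMetric {
  is_metric_ge0 : forall x y, 0 <= d x y;
  is_metric_eq0 : forall x y, d x y = 0 <-> x = y;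
  is_metric_sym : forall x y, d x y = d y x;
  is_metric_triangle : forall x y z, d x z <= d x y + d y z }.

Definition metric_topology (d : X -> X -> R) : set (set X) :=
  [set U | forall x, U x ->
     exists2 e : R, 0 < e & [set y | d x y < e] `<=` U].

Definition metrizable (sigma : set (set X)) : Prop :=
  exists2 d : X -> X -> R, is_metric d & sigma = metric_topology d.

Definition subspace_topology (sigma : set (set X)) (A : set X) :
    set (set X) :=
  [set A `&` U | U in sigma].

Definition rho (d : X -> X -> R) (s : X -> R) (x y : X) : R :=
  `|s x - s y| + Num.min (s x) (s y) * d x y.

Definition tau_ (d : X -> X -> R) (s : X -> R) : set (set X) :=
  metric_topology (rho d s).

Definition preceq (s t : X -> R) : Prop :=
  forall e : R, 0 < e ->
    exists2 delta : R, 0 < delta &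
      [set x | t x < delta] `<=` [set x | s x < e].

Definition asymp (s t : X -> R) : Prop := preceq s t /\ preceq t s.

Lemma preceq_refl s : preceq s s.
Proof. by move=> e e0; exists e. Qed.

Lemma preceq_trans s t u : preceq s t -> preceq t u -> preceq s u.
Proof.
move=> st tu e /st[d d0 ds]; have [c c0 cd] := tu _ d0.
by exists c => // x /cd /ds.
Qed.

End metric_topologies.

Section metricType_compatibility.
Variables (R : realType) (T : metricType R).

Lemma mdist_is_metric : is_metric (mdist : T -> T -> R).
Proof.
split; [exact: mdist_ge0| |exact: metric_sym|exact: metric_triangle].
by move=> x y; split => [/mdist_positivity|->] //; exact: mdistxx.
Qed.

Lemma metric_topology_mdist :
  metric_topology (mdist : T -> T -> R) = (open : set (set T)).
Proof.
apply/funext => U; apply/propext; rewrite openE /interior.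
split => H x Ux.
  have [e e0 eU] := H x Ux.
  by apply/nbhs_ballP; exists e => //; rewrite ballEmdist.
have /nbhs_ballP[e e0] := H x Ux.
by rewrite ballEmdist => eU; exists e.
Qed.

End metricType_compatibility.

Section gauges.
Variables (R : realType) (X : topologicalType) (a : X).

Definition Ga : set (X -> R) :=
  [set s : X -> R | [/\ continuous s, forall x, 0 <= s x & s @^-1` [set 0] = [set a]]].

Definition Lma : set (set (set X)) :=
  [set sigma : set (set X) | [/\ metrizable R sigma,
     sigma `<=` open &
     subspace_topology sigma (~` [set a]) =
       subspace_topology open (~` [set a])]].

Definition asympb (s t : Ga) : bool := `[< asymp (val s) (val t) >].

Lemma asympb_refl : reflexive asympb.
Proof. by move=> s; apply/asboolP; split; exact: preceq_refl. Qed.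

Lemma asympb_sym : symmetric asympb.
Proof. by move=> s t; apply/asboolP/asboolP => -[]. Qed.

Lemma asympb_trans : transitive asympb.
Proof.
move=> t s u /asboolP[st ts] /asboolP[tu ut]; apply/asboolP.
by split; [exact: preceq_trans tu|exact: preceq_trans ts].
Qed.

Canonical asympb_equiv := EquivRel asympb asympb_refl asympb_sym asympb_trans.

Definition GaQ : Type := {eq_quot asympb}%qT.
HB.instance Definition _ := Choice.on GaQ.
HB.instance Definition _ := EqQuotient.on GaQ.

(* Comparing canonical representatives is comparing arbitrary ones:
   see [GaQ_le_pi]. *)
Definition GaQ_le (p q : GaQ) : bool :=
  `[< preceq (val (repr p)) (val (repr q)) >].

Lemma GaQ_le_pi (s t : Ga) :
  GaQ_le (\pi_GaQ s)%qT (\pi_GaQ t)%qT = `[< preceq (val s) (val t) >].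
Proof.
have H u : asymp (val (repr (\pi_GaQ u)%qT)) (val (u : Ga)).
  by apply/asboolP; have /eqmodP := reprK (\pi_GaQ u)%qT.
have [ss' s's] := H s; have [tt' t't] := H t.
apply/asboolP/asboolP => st.
  exact: preceq_trans (preceq_trans s's st) tt'.
exact: preceq_trans (preceq_trans ss' st) t't.
Qed.

Lemma GaQ_le_refl : reflexive GaQ_le.
Proof. by move=> p; apply/asboolP; exact: preceq_refl. Qed.

Lemma GaQ_le_anti : antisymmetric GaQ_le.
Proof.
move=> p q /andP[/asboolP pq /asboolP qp].
by rewrite -(reprK p) -(reprK q); apply/eqmodP/asboolP.
Qed.

Lemma GaQ_le_trans : transitive GaQ_le.
Proof.
by move=> q p r /asboolP pq /asboolP qr; apply/asboolP; exact: preceq_trans qr.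
Qed.

Fact GaQ_display : Order.disp_t. Proof. exact: Order.default_display. Qed.

HB.instance Definition _ := Order.Le_isPOrder.Build GaQ_display GaQ
  GaQ_le_refl GaQ_le_anti GaQ_le_trans.

End gauges.

Arguments Ga R {X} a _.
Arguments Lma R {X} a _.
Arguments GaQ R {X} a.

(* Main.v *)
Require Import Defs.
From mathcomp Require Import all_boot all_order all_algebra generic_quotient.
From mathcomp Require Import all_classical all_reals all_analysis.
From mathcomp Require Import lra.
Import Order.TTheory GRing.Theory Num.Theory.
Import numFieldNormedType.Exports.
Local Open Scope classical_set_scope.
Local Open Scope ring_scope.

(** For a gauge [s] at [a], the balls of [rho d s] around [a] are the sublevel
    sets of [s], because [rho d s a y = s y]; around any other point [x] the
    factor [min (s x) (s y)] stays close to the positive number [s x], so that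
    small [rho d s]-balls and small [d]-balls refine each other. Hence
    ([in_tau_]) a set is open for [tau_ d s] exactly when it is open in [X] and,
    if it contains [a], contains a sublevel set [s < e] with [e > 0]. Everything
    is read off this description.

    Comparison ([tau_subset_preceq]): the sublevel sets of [s] are themselves
    members of [tau_ d s], so an inclusion of [tau_ d s] in [tau_ d t] puts a
    sublevel set of [t] inside each of them, which is [preceq s t]; the converse
    is transitivity of inclusion. Equality of topologies is then [asymp], so
    the map on classes is well defined, injective and an order embedding.

    Range: [rho d s] is a metric ([rho_is_metric], where [d <= 1] is needed),
    and deleting the closed point [a] from an open set gives a member of
    [tau_ d s]; so [tau_ d s] lies in [Lma] ([tau_Lma]). Conversely, if [sigma]
    in [Lma] is induced by a metric [r], the distance [r a] to the point [a] is
    a gauge and [sigma = tau_ d (r a)] ([Lma_tau]): both topologies have the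
    same neighbourhoods of [a], and away from [a] both agree with [X]. *)

(** * Balls and neighbourhoods in the topology of a metric *)

Section metric_topology_theory.
Context {R : realType}.

Lemma is_metric_xx {X : Type} {d : X -> X -> R} (d_metric : is_metric d) x :
  d x x = 0.
Proof. exact/(is_metric_eq0 d_metric). Qed.

Lemma is_metric_gt0 {X : Type} {d : X -> X -> R} (d_metric : is_metric d) x y :
  x <> y -> 0 < d x y.
Proof.
move=> xy; rewrite lt_neqAle (is_metric_ge0 d_metric) andbT eq_sym.
by apply/eqP => /(is_metric_eq0 d_metric).
Qed.

Lemma ball_in_metric_topology {X : Type} {d : X -> X -> R}
    (d_metric : is_metric d) x e :
  metric_topology d [set y | d x y < e].
Proof.
move=> y /= xye; exists (e - d x y); first by rewrite subr_gt0.
move=> z /= yz; have := is_metric_triangle d_metric x y z; lra.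
Qed.

Lemma nbhs_metric_topology {X : topologicalType} {d : X -> X -> R}
    (d_metric : is_metric d) (d_compatible : metric_topology d = open)
    (x : X) (A : set X) :
  nbhs x A <-> exists2 e : R, 0 < e & [set y | d x y < e] `<=` A.
Proof.
rewrite nbhsE; split=> [[U [oU Ux] UA]|[e e0 eA]].
  move: oU; rewrite -d_compatible => /(_ x Ux)[e e0 eU].
  by exists e => //; exact: subset_trans UA.
exists [set y | d x y < e] => //; split;
  last by rewrite /= (is_metric_xx d_metric).
by rewrite -d_compatible; exact: ball_in_metric_topology.
Qed.

Lemma open_setC1_metric_topology {X : topologicalType} {d : X -> X -> R}
    (d_metric : is_metric d) (d_compatible : metric_topology d = open)
    (a : X) : open (~` [set a]).
Proof.
rewrite -d_compatible => x /= xa; exists (d x a); first exact: is_metric_gt0.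
by move=> y /= + ya; rewrite ya ltxx.
Qed.

End metric_topology_theory.

(** * The topology of a gauge *)

Section tau_theory.
Context {R : realType} {X : topologicalType} {a : X} {d : X -> X -> R}.
Hypothesis d_metric : is_metric d.
Hypothesis d_le1 : forall x y, d x y <= 1.
Hypothesis d_compatible : metric_topology d = open.

Lemma Ga_eq0 {s : X -> R} : Ga R a s -> forall x, s x = 0 <-> x = a.
Proof.
move=> [_ _ s0] x; rewrite -[s x = 0]/((s @^-1` [set 0]) x).
by rewrite s0.
Qed.

Lemma Ga_gt0 {s : X -> R} : Ga R a s -> forall x, x <> a -> 0 < s x.
Proof.
move=> Gs x xa; have [_ s_ge0 _] := Gs.
by rewrite lt_neqAle s_ge0 andbT eq_sym; apply/eqP => /(Ga_eq0 Gs).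
Qed.

(** Let [m] be the weight [min (s x) (s z)] of the direct leg. If [m <= s y],
    both legs through [y] weigh at least [m], and the triangle inequalities of
    [d] and of the real line add up. Otherwise the detour of [s] down to [s y]
    costs [2 * (m - s y)], while giving [d] the weight [s y] instead of [m]
    saves [(m - s y) * d x z], which is at most [m - s y] because [d <= 1]. *)
Lemma rho_is_metric {s : X -> R} : Ga R a s -> is_metric (rho d s).
Proof.
move=> Gs; have [_ s_ge0 _] := Gs.
have d_ge0 := is_metric_ge0 d_metric.
split=> [x y|x y|x y|x y z]; rewrite /rho.
- by rewrite addr_ge0 // mulr_ge0 // le_min !s_ge0.
- split=> [|->]; last first.
    by rewrite subrr normr0 (is_metric_xx d_metric) mulr0 addr0.
  move/eqP; rewrite paddr_eq0 // ?mulr_ge0 // ?le_min ?s_ge0 //.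
  rewrite normr_eq0 subr_eq0 => /andP[/eqP sxy].
  rewrite sxy minxx mulf_eq0 => /orP[|] /eqP.
    move=> sy0; have /(Ga_eq0 Gs) -> := sy0.
    by apply/(Ga_eq0 Gs); rewrite sxy.
  by move/(is_metric_eq0 d_metric).
- by rewrite distrC minC (is_metric_sym d_metric).
- have dxyz := is_metric_triangle d_metric x y z.
  have [m_le|m_gt] := lerP (Num.min (s x) (s z)) (s y).
    have mx : Num.min (s x) (s z) <= Num.min (s x) (s y).
      by rewrite le_min m_le ge_min lexx.
    have mz : Num.min (s x) (s z) <= Num.min (s y) (s z).
      by rewrite le_min m_le ge_min lexx orbT.
    rewrite addrACA lerD ?ler_distD //.
    apply: (@le_trans _ _ (Num.min (s x) (s z) * (d x y + d y z))).
      by rewrite ler_wpM2l // le_min !s_ge0.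
    by rewrite mulrDr lerD // ler_wpM2r.
  have /andP[yx yz] : (s y < s x) && (s y < s z) by rewrite -lt_min.
  rewrite [Num.min (s x) (s y)]min_r ?[Num.min (s y) (s z)]min_l ?ltW //.
  rewrite [`|s x - s y|]gtr0_norm ?subr_gt0 //.
  rewrite [`|s y - s z|]distrC [`|s z - s y|]gtr0_norm ?subr_gt0 //.
  have lost : (Num.min (s x) (s z) - s y) * d x z <=
      Num.min (s x) (s z) - s y.
    by rewrite ler_piMr // subr_ge0 ltW.
  have legs : s y * d x z <= s y * d x y + s y * d y z.
    by rewrite -mulrDr ler_wpM2l.
  have spread : `|s x - s z| = s x + s z - 2 * Num.min (s x) (s z).
    by case: (lerP (s x) (s z)) => _; lra.
  rewrite spread; lra.
Qed.

Lemma rho_center {s : X -> R} : Ga R a s -> rho d s a = s.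
Proof.
move=> Gs; apply/funext => y; have [_ s_ge0 _] := Gs.
have sa : s a = 0 by exact/(Ga_eq0 Gs).
by rewrite /rho sa min_l // mul0r addr0 sub0r normrN ger0_norm.
Qed.

(** Openness in [X] comes from the bound
    [rho d s x y <= `|s x - s y| + s x * d x y], whose right-hand side is small
    for [y] near [x]. For the converse at [x <> a], [rho d s x y < s x / 2]
    forces [s y > s x / 2], and then [rho d s x y] dominates
    [(s x / 2) * d x y], so that a small [rho d s]-ball lies in a [d]-ball. *)
Lemma in_tau_ {s : X -> R} : Ga R a s -> forall U : set X,
  tau_ d s U <->
  open U /\ (U a -> exists2 e : R, 0 < e & [set x | s x < e] `<=` U).
Proof.
move=> Gs U; have [s_cont s_ge0 _] := Gs.
have d_ge0 := is_metric_ge0 d_metric.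
split=> [tU|[oU Ua] x Ux].
  split; last by move=> /tU[e e0]; rewrite rho_center//; exists e.
  rewrite openE => x Ux; rewrite /interior.
  have [e e0 eU] := tU x Ux.
  (* [s x + 1] rather than [s x] as the bound of the weight: [s x] may be 0. *)
  pose e' := e / (2 * (s x + 1)).
  have sx1 : 0 < s x + 1 by rewrite ltr_pwDr.
  have e'0 : 0 < e' by rewrite divr_gt0 // mulr_gt0.
  have e20 : 0 < e / 2 by rewrite divr_gt0.
  have nd : nbhs x [set y | d x y < e'].
    by apply/(nbhs_metric_topology d_metric d_compatible); exists e'.
  have ns : nbhs x [set y | `|s x - s y| < e / 2].
    by have /cvgrPdist_lt/(_ _ e20) := s_cont x.
  apply: filterS (filterI nd ns) => y [/= dy sy]; apply: eU; rewrite /= /rho.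
  have : Num.min (s x) (s y) * d x y <= (s x + 1) * d x y.
    by rewrite ler_wpM2r // ge_min lerDl ler01.
  have : (s x + 1) * d x y < e / 2.
    by move: dy; rewrite /e' invfM mulrA ltr_pdivlMr // mulrC.
  lra.
have [xa|xa] := pselect (x = a).
  move: Ux; rewrite xa => /Ua[e e0 eU].
  by exists e => //; rewrite rho_center.
have sx0 := Ga_gt0 Gs _ xa.
move: oU; rewrite -d_compatible => /(_ x Ux)[r r0 rU].
exists (Num.min (s x / 2) (s x / 2 * r)).
  by rewrite lt_min !mulr_gt0 ?divr_gt0.
move=> y /=; rewrite /rho lt_min => /andP[lt_half lt_r].
have sy : s x / 2 < s y.
  have : 0 <= Num.min (s x) (s y) * d x y by rewrite mulr_ge0 // le_min !s_ge0.
  have := ler_norm (s x - s y); lra.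
apply: rU; rewrite /= -(ltr_pM2l (divr_gt0 sx0 (ltr0Sn R 1))).
apply: le_lt_trans lt_r; rewrite -[leLHS]add0r lerD //.
by rewrite ler_wpM2r // le_min (ltW sy) andbT; lra.
Qed.

Lemma sublevel_in_tau_ {s : X -> R} {e : R} : Ga R a s -> 0 < e ->
  tau_ d s [set x | s x < e].
Proof.
move=> Gs e0; apply/(in_tau_ Gs); split; last by exists e.
have [s_cont _ _] := Gs.
by apply: (open_comp (D := [set y | y < e])) => //; move=> x _; exact: s_cont.
Qed.

Lemma tau_subset_preceq {s t : X -> R} : Ga R a s -> Ga R a t ->
  tau_ d s `<=` tau_ d t <-> preceq s t.
Proof.
move=> Gs Gt; split=> [st e e0|st U /(in_tau_ Gs)[oU Ua]].
  have /st/(in_tau_ Gt)[_] := sublevel_in_tau_ Gs e0; apply.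
  by have /(Ga_eq0 Gs) /= -> := erefl a.
apply/(in_tau_ Gt); split=> // /Ua[e /st[c c0 ce] eU].
by exists c => //; exact: subset_trans eU.
Qed.

Lemma tau_eq_asymp {s t : X -> R} : Ga R a s -> Ga R a t ->
  tau_ d s = tau_ d t <-> asymp s t.
Proof.
move=> Gs Gt; rewrite /asymp -(tau_subset_preceq Gs Gt).
rewrite -(tau_subset_preceq Gt Gs).
by split=> [->|st]; [split|exact/seteqP].
Qed.

Lemma tau_Lma {s : X -> R} : Ga R a s -> Lma R a (tau_ d s).
Proof.
move=> Gs; split; first by exists (rho d s) => //; exact: rho_is_metric.
  by move=> U /(in_tau_ Gs)[].
apply/seteqP; split=> _ [U tU <-].
  have [oU _] := (in_tau_ Gs U).1 tU.
  by exists U.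
exists (~` [set a] `&` U); last by rewrite setIA setIid.
apply/(in_tau_ Gs); split; last by move=> [na _]; case: (na erefl).
by apply: openI => //;
  exact: open_setC1_metric_topology d_metric d_compatible a.
Qed.

Lemma dist_Ga {r : X -> X -> R} : is_metric r ->
  metric_topology r `<=` open -> Ga R a (r a).
Proof.
move=> r_metric r_open; split; last 2 first.
- by move=> x; exact: is_metric_ge0.
- apply/seteqP; split=> x /=; first by move/(is_metric_eq0 r_metric).
  by move=> ->; exact: is_metric_xx.
move=> x; apply/cvgrPdist_lt => e e0.
suff : nbhs x [set y | r x y < e].
  apply: filterS => y /= xye; rewrite ltr_norml.
  have := is_metric_triangle r_metric a x y.
  have := is_metric_triangle r_metric a y x.
  rewrite (is_metric_sym r_metric y x); lra.
apply: open_nbhs_nbhs; split; last by rewrite /= (is_metric_xx r_metric).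
exact/r_open/(ball_in_metric_topology r_metric).
Qed.

(** A [sigma]-ball around [x <> a] is cut down to radius at most [r x a] so
    that it avoids [a], where nothing is known about the trace of [sigma]. *)
Lemma Lma_tau (sigma : set (set X)) : Lma R a sigma ->
  exists2 s : X -> R, Ga R a s & tau_ d s = sigma.
Proof.
move=> [[r r_metric ->] r_open r_trace].
have Gr := dist_Ga r_metric r_open; exists (r a) => //.
apply/seteqP; split=> U; last first.
  by move=> rU; apply/(in_tau_ Gr); split; [exact: r_open|exact: rU].
move=> /(in_tau_ Gr)[oU Ua] x Ux.
have [xa|xa] := pselect (x = a); first by rewrite xa; apply: Ua; rewrite -xa.
have [V rV VU] : subspace_topology (metric_topology r) (~` [set a])
    (~` [set a] `&` U) by rewrite r_trace; exists U.
have [_ Vx] : (~` [set a] `&` V) x by rewrite VU.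
have [e e0 eV] := rV x Vx.
exists (Num.min e (r x a)); first by rewrite lt_min e0 is_metric_gt0.
move=> y /=; rewrite lt_min => /andP[ye ya].
suff [] : (~` [set a] `&` U) y by [].
rewrite -VU; split; last exact: eV.
by move=> /= yE; rewrite yE ltxx in ya.
Qed.

End tau_theory.

(** * The order isomorphism *)

Theorem theorem3p5 (R : realType) (X : topologicalType) (a : X)
    (metrizable_X : metrizable R (open : set (set X)))
    (d : X -> X -> R) (d_metric : is_metric d) (d_le1 : forall x y, d x y <= 1)
    (d_compatible : metric_topology d = open) :
  [/\ forall s t : X -> R, Ga R a s -> Ga R a t ->
        (tau_ d s `<=` tau_ d t <-> preceq s t),
      forall s t : X -> R, Ga R a s -> Ga R a t ->
        (tau_ d s = tau_ d t <-> asymp s t) &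
      exists Phi : GaQ R a -> set (set X),
        [/\ forall s : Ga R a, Phi (\pi_(GaQ R a) s)%qT = tau_ d (val s),
            set_bij [set: GaQ R a] (Lma R a) Phi &
            forall p q : GaQ R a, (p <= q)%O <-> Phi p `<=` Phi q]].
Proof.
have GaP (s : Ga R a) : Ga R a (val s) by exact: set_valP.
have tau_le s t := @tau_subset_preceq R X a d d_metric d_compatible s t.
have tau_eq s t := @tau_eq_asymp R X a d d_metric d_compatible s t.
split=> //.
pose Phi (p : GaQ R a) := tau_ d (val (repr p)).
have Phi_pi (s : Ga R a) : Phi (\pi_(GaQ R a) s)%qT = tau_ d (val s).
  apply/tau_eq => //; apply/asboolP.
  by have /eqmodP := reprK (\pi_(GaQ R a) s)%qT.
have Phi_le (p q : GaQ R a) : (p <= q)%O <-> Phi p `<=` Phi q.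
  rewrite tau_le //; split; first by move/asboolP.
  by move=> ?; apply/asboolP.
exists Phi; split=> //; split.
- by move=> p _; exact: tau_Lma.
- move=> p q _ _ pq; apply/le_anti/andP.
  by split; apply/Phi_le; rewrite pq.
- move=> sigma /(Lma_tau d_metric d_compatible)[s Gs <-].
  exists (\pi_(GaQ R a) (SigSub (mem_set Gs)))%qT => //.
Qed.
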